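(* Suppose $\mathfrak{a}\in C^2(\mathbb{R})$ with $\mathfrak{a}'(v_0)>0$ and $\mathfrak{a}''(v_0)>0$ for some $v_0\in\mathbb{R}$. Let $\mathfrak{F}$ be an antiderivative of $\mathfrak{a}$, let $$P(u,v):=\begin{pmatrix} u & v\\ \mathfrak{a}(v) & u\\ u\,\mathfrak{a}(v) & \frac12u^2+\mathfrak{F}(v)\end{pmatrix}\in M^{3\times 2}\quad (u,v\in\mathbb{R}),$$ and let $\mathcal{K}_1:=\{P(u,v):u,v\in\mathbb{R}\}$. Then for any $u_0\in\mathbb{R}$ there exists some neighborhood $U\subset M^{3\times 2}$ of $P(u_0,v_0)$ such that $\mathcal{K}_1\cap U$ does not contain $\mathbb{T}_4$ configurations, i.e. no ordered set of four matrices of $\mathcal{K}_1\cap U$ forms a $\mathbb{T}_4$ configuration.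
   Context: $M^{m\times n}$ is the set of real $m\times n$ matrices. Two matrices $A,B$ are Rank-1 connected if $\mathrm{Rank}(A-B)=1$. An ordered set of $N\geq 4$ (pairwise distinct) matrices $\{T_i\}_{i=1}^N\subset M^{m\times n}$ without Rank-1 connections (no two of them are Rank-1 connected) is said to form a $\mathbb{T}_N$ configuration if there exist matrices $P_*,C_1,\dots,C_N\in M^{m\times n}$ and numbers $\kappa_i>1$ such that $T_i=P_*+C_1+\dots+C_{i-1}+\kappa_iC_i$ for $i=1,\dots,N$ (so $T_1=P_*+\kappa_1C_1$), where $\mathrm{Rank}(C_i)=1$ for all $i$ and $\sum_{i=1}^NC_i=0$. *)

(* Defs.v *)
From HB Require Import structures.
From mathcomp Require Import all_boot all_order all_algebra.
From mathcomp Require Import all_classical all_reals all_analysis.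
Import Order.TTheory GRing.Theory Num.Theory.
Import numFieldNormedType.Exports.

Set Implicit Arguments.
Unset Strict Implicit.
Unset Printing Implicit Defensive.

Local Open Scope ring_scope.
Local Open Scope classical_set_scope.

(* Continuity of the derivatives of order < k follows from differentiability. *)
Definition class_C (R : realType) (k : nat) (f : R -> R) : Prop :=
  (forall i : nat, (i < k)%N -> forall x : R, derivable f^`(i) x 1) /\
  continuous f^`(k).

Definition antiderivative (R : realType) (F f : R -> R) : Prop :=
  forall x : R, is_derive x 1 F (f x).

Definition rank1_connected (R : realType) (m n : nat) (A B : 'M[R]_(m, n)) :
  Prop := \rank (A - B) = 1%N.

(* Indices run over 0, ..., N-1, so that the empty partial sum gives
   T 0 = P + kappa 0 *: C 0. *)
Definition TN_configuration (R : realType) (m n N : nat)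
    (T : 'I_N -> 'M[R]_(m, n)) : Prop :=
  [/\ (4 <= N)%N,
      injective T,
      forall i j : 'I_N, ~ rank1_connected (T i) (T j) &
      exists (P : 'M[R]_(m, n)) (C : 'I_N -> 'M[R]_(m, n)) (kappa : 'I_N -> R),
        [/\ forall i, 1 < kappa i,
            forall i, \rank (C i) = 1%N,
            \sum_i C i = 0 &
            forall i : 'I_N,
              T i = P + \sum_(j < N | (j < i)%N) C j + kappa i *: C i]].

Definition Pmx (R : realType) (a F : R -> R) (u v : R) : 'M[R]_(3, 2) :=
  \matrix_(i < 3, j < 2)
    nth 0 (nth [::] [:: [:: u;       v];
                        [:: a v;     u];
                        [:: u * a v; 2^-1 * u ^+ 2 + F v]] i) j.

Definition K1 (R : realType) (a F : R -> R) : set 'M[R]_(3, 2) :=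
  [set M | exists u v : R, M = Pmx a F u v].

(* Main.v *)
(* For a T_N configuration T and each k, a given 2 x 2 minor cannot have the
   same strict sign on all differences T i - T k, because minors are affine
   along the rank-one segments of the pinwheel. Moreover four matrices in
   M^{3x2} forming a T_4 always satisfy a common relation l *m T i = const with
   l nonzero. On K_1, where a is increasing and strictly convex, l must involve
   the third row, and the relation then makes the sign of the minor of the first
   two rows of T i - T j opposite to that of b i + b j, with
   b i = a (v i) + const. As b increases with v, the points with minimal and
   maximal v force b_min + b_max to be both positive and not positive. *)
Require Import Defs.
From mathcomp Require Import all_boot all_order all_algebra.
From mathcomp Require Import all_classical all_reals all_analysis.
From mathcomp Require Import ring lra.
Import Order.TTheory GRing.Theory Num.Theory.
Import numFieldNormedType.Exports.
Set Implicit Arguments.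
Unset Strict Implicit.
Unset Printing Implicit Defensive.
Local Open Scope ring_scope.
Local Open Scope classical_set_scope.

(** * Linear relations among the matrices of a T_N configuration *)

Lemma mxrank1P (K : fieldType) (m n : nat) (M : 'M[K]_(m, n)) :
  \rank M = 1%N -> exists (c : 'cV[K]_m) (r : 'rV[K]_n), M = c *m r.
Proof.
move=> M1; move: (col_base M) (row_base M) (mulmx_base M).
by rewrite M1 => c r <-; exists c, r.
Qed.

Lemma not_row_free_ker (K : fieldType) (m n : nat) (M : 'M[K]_(m, n)) :
  ~~ row_free M -> exists2 w : 'rV[K]_m, w != 0 & w *m M = 0.
Proof.
rewrite -kermx_eq0 => /rowV0Pn[w wM w0]; exists w => //; exact/sub_kermxP.
Qed.

(** A nonzero kernel vector of the two-column matrix [A - B] leaves rank at most 1. *)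
Lemma kernel_rank1_connected (R : realType) (m : nat) (A B : 'M[R]_(m, 2))
    (w : 'rV[R]_2) :
  A != B -> w != 0 -> A *m w^T = B *m w^T -> rank1_connected A B.
Proof.
move=> AB w0 ABw; apply/eqP; rewrite eqn_leq.
rewrite lt0n mxrank_eq0 subr_eq0 AB andbT.
have /mulmx0_rank_max : (A - B) *m w^T = 0 by rewrite mulmxBl ABw subrr.
by rewrite mxrank_tr rank_rV w0 addn1 ltnS.
Qed.

(* Write C i = c i *m r i. Since \sum_i c i *m r i = 0, the ranks of the
   families c and r add up to at most N, so either c does not span the column
   space or all the r i are parallel; the latter yields rank-1 connections. *)
Lemma TN_row_relation (R : realType) (m N : nat) (T : 'I_N -> 'M[R]_(m, 2)) :
  (N <= m.+1)%N -> TN_configuration T ->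
  exists2 l : 'rV[R]_m, l != 0 & forall i j, l *m T i = l *m T j.
Proof.
move=> Nm [N4 Tinj Tnr1 [P [C [k [_ C1 C0 TE]]]]].
have /choice[cr crE] i : exists cr : 'cV[R]_m * 'rV[R]_2, C i = cr.1 *m cr.2.
  by have [c [r ->]] := mxrank1P (C1 i); exists (c, r).
pose A := \matrix_(p < m, i < N) (cr i).1 p 0.
pose B := \matrix_(i < N, q < 2) (cr i).2 0 q.
have AB0 : A *m B = 0.
  rewrite -C0; apply/matrixP => p q; rewrite !mxE summxE; apply: eq_bigr => i _.
  by rewrite crE !mxE big_ord1.
have [Afree|/not_row_free_ker[l l0 lA]] := boolP (row_free A); last first.
  exists l => //.
  suff lT i : l *m T i = l *m P by move=> i j; rewrite !lT.
  have lC j : l *m C j = 0.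
    suff lc : l *m (cr j).1 = 0 by rewrite crE mulmxA lc mul0mx.
    have /colP/(_ j) := congr1 trmx lA; rewrite !mxE => lAj.
    apply/matrixP => p q; rewrite !ord1 !mxE -[RHS]lAj.
    by apply: eq_bigr => s _; rewrite mxE.
  rewrite TE !mulmxDr -scalemxAr lC scaler0 addr0 mulmx_sumr big1 ?addr0 //.
(* As [A *m B = 0] and [A] has rank [m], the rank of [B] is at most [N - m <= 1]. *)
have /not_row_free_ker[w w0 wB] : ~~ row_free B^T.
  rewrite /row_free mxrank_tr neq_ltn; apply/orP; left.
  have := mulmx0_rank_max AB0; rewrite (eqP Afree) => mBN.
  by rewrite -(ltn_add2l m) addn2 ltnS (leq_trans mBN).
have Tw i : T i *m w^T = P *m w^T.
  have Cw j : C j *m w^T = 0.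
    suff rw : (cr j).2 *m w^T = 0 by rewrite crE -mulmxA rw mulmx0.
    have /rowP/(_ j) := wB; rewrite !mxE => wBj.
    apply/matrixP => p q; rewrite !ord1 !mxE -[RHS]wBj.
    by apply: eq_bigr => s _; rewrite !mxE mulrC.
  rewrite TE !mulmxDl -scalemxAl Cw scaler0 addr0 mulmx_suml big1 ?addr0 //.
have N0 : (0 < N)%N by apply: leq_trans N4.
have N1 : (1 < N)%N by apply: leq_trans N4.
case: (Tnr1 (Ordinal N0) (Ordinal N1)).
by apply: (@kernel_rank1_connected _ _ _ _ w); rewrite ?(inj_eq Tinj) // !Tw.
Qed.

(** * Signs of 2 x 2 minors on a T_N configuration *)

Definition minor2 (R : realType) (m : nat) (p q : 'I_m)
    (X : 'M[R]_(m, 2)) : R :=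
  X p 0 * X q 1 - X p 1 * X q 0.

(** The quadratic part of the minor vanishes on a rank-one [C], so the minor is affine along
    [X + t *: C]; it is interpolated here at [t = 0, 1, k]. *)
Lemma minor2_rank1_affine (R : realType) (m : nat) (p q : 'I_m)
    (X C : 'M[R]_(m, 2)) (k : R) : \rank C = 1%N ->
  k * minor2 p q (X + C) = (k - 1) * minor2 p q X + minor2 p q (X + k *: C).
Proof.
move=> /mxrank1P[c [r ->]]; rewrite /minor2 !mxE !big_ord1; ring.
Qed.

Lemma minor2_rank1 (R : realType) (m : nat) (p q : 'I_m)
    (C : 'M[R]_(m, 2)) : \rank C = 1%N -> minor2 p q C = 0.
Proof. move=> /mxrank1P[c [r ->]]; rewrite /minor2 !mxE !big_ord1; ring. Qed.

Lemma minor2N (R : realType) (m : nat) (p q : 'I_m) (X : 'M[R]_(m, 2)) :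
  minor2 p q (- X) = minor2 p q X.
Proof. by rewrite /minor2 !mxE; ring. Qed.

(** The pinwheel closes up: [ordS] wraps the last index to 0, where the empty sum agrees with the
    vanishing full sum. *)
Lemma ord_sum_ordS (V : zmodType) (N : nat) (C : 'I_N -> V) (i : 'I_N) :
  \sum_i C i = 0 ->
  \sum_(j < N | (j < ordS i)%N) C j = \sum_(j < N | (j < i)%N) C j + C i.
Proof.
move=> C0.
have -> : \sum_(j < N | (j < i)%N) C j + C i = \sum_(j < N | (j <= i)%N) C j.
  rewrite [RHS](bigD1 i) //= addrC; congr (_ + _); apply: eq_bigl => j.
  by rewrite ltn_neqAle andbC.
have [iN|] := ltnP i.+1 N; first by apply: eq_bigl => j; rewrite /= modn_small.
move=> iN; have {}iN : i.+1 = N by apply/eqP; rewrite eqn_leq ltn_ord.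
rewrite big_pred0 => [|j]; last by rewrite /= iN modnn.
by rewrite -[LHS]C0; apply: eq_bigl => j; rewrite -ltnS iN ltn_ord.
Qed.

(* With P i the vertices of the pinwheel, P (i + 1) lies on the rank-one
   segment from P i to T i, on which X |-> minor2 (X - T k) is affine. At its
   minimum over the P i this function is at least some value at a T i, hence
   nonnegative, while it vanishes at P k and is positive at T (k - 1). *)
Lemma TN_minor2_sign (R : realType) (m N : nat) (T : 'I_N -> 'M[R]_(m, 2))
    (p q : 'I_m) (k : 'I_N) : TN_configuration T ->
  ~ (forall i, i != k -> 0 < minor2 p q (T i - T k)).
Proof.
move=> [N4 _ _ [P [C [x [x1 C1 C0 TE]]]]] Tk.
pose Q (i : 'I_N) := P + \sum_(j < N | (j < i)%N) C j.
pose f i := minor2 p q (Q i - T k).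
have fS i : x i * f (ordS i) = (x i - 1) * f i + minor2 p q (T i - T k).
  have -> : T i - T k = Q i - T k + x i *: C i by rewrite TE addrAC.
  rewrite -minor2_rank1_affine // /f; congr (_ * minor2 _ _ _).
  by rewrite /Q ord_sum_ordS // addrA [RHS]addrAC.
have fk : f k = 0.
  rewrite /f TE opprD addrA subrr sub0r minor2N -[LHS]/(minor2 p q (x k *: C k)).
  apply: minor2_rank1; rewrite mxrank_scale_nz //.
  by rewrite gt_eqF // (lt_trans ltr01).
have Tk0 i : 0 <= minor2 p q (T i - T k).
  have [->|/Tk/ltW//] := eqVneq i k.
  by rewrite subrr /minor2 !mxE mul0r subrr.
have f0 i : 0 <= f i.
  have [j _ jmin] := arg_minP f (isT : xpredT k).
  apply: le_trans (jmin i isT).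
  have := fS (ord_pred j); rewrite ord_predK.
  have := jmin (ord_pred j) isT; have := Tk0 (ord_pred j).
  have := x1 (ord_pred j); nra.
have pk : ord_pred k != k.
  rewrite -(inj_eq (bij_inj (ordS_bij N))) ord_predK -val_eqE /=.
  have [kN|kN] := ltnP k.+1 N; first by rewrite modn_small // ltn_eqF.
  have {}kN : k.+1 = N by apply/eqP; rewrite eqn_leq ltn_ord.
  by rewrite kN modnn; apply/eqP => k0; move: N4; rewrite -kN k0.
have := fS (ord_pred k); rewrite ord_predK fk.
have := Tk _ pk; have := f0 (ord_pred k); have := x1 (ord_pred k); nra.
Qed.

(** * Strict convexity of the flux on an interval *)

Section ConvexFlux.
Context (R : realType) (a da F : R -> R) (J : interval R).
Hypothesis a_derive : forall x : R, is_derive x 1 a (da x).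
Hypothesis F_anti : antiderivative F a.
Hypothesis da_incr : {in J &, {homo da : x y / x < y}}.

Lemma itv_between (x y z : R) : x \in J -> z \in J -> y \in `]x, z[%R -> y \in J.
Proof.
move=> xJ zJ /itvP xyz; apply: (interval_is_interval xJ zJ).
by rewrite !xyz.
Qed.

Lemma flux_MVT (x y : R) : x < y ->
  exists2 c, c \in `]x, y[%R & a y - a x = da c * (y - x).
Proof.
move=> xy; apply: MVT => //.
by apply: derivable_within_continuous => z _; apply: ex_derive.
Qed.

Lemma flux_chord (x y z : R) : x \in J -> z \in J -> x < y < z ->
  (a y - a x) * (z - y) < (a z - a y) * (y - x).
Proof.
move=> xJ zJ /andP[xy yz].
have yJ : y \in J by apply: (itv_between xJ zJ); rewrite in_itv /= xy.
have [c /[dup] /(itv_between xJ yJ) cJ + ->] := flux_MVT xy.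
have [d /[dup] /(itv_between yJ zJ) dJ + ->] := flux_MVT yz.
rewrite !in_itv /= => /andP[yd _] /andP[_ cy].
have := da_incr cJ dJ (lt_trans cy yd).
rewrite -mulrA (mulrC (y - x)) mulrA ltr_pM2r ?subr_gt0 // ltr_pM2r ?subr_gt0 //.
Qed.

(** The trapezoid defect [g] has derivative [(t - x) * (da t - da d)] at [t > x], for some [d]
    between [x] and [t], and this is positive. *)
Lemma flux_trapezoid (x y : R) : x \in J -> y \in J -> x < y ->
  2 * (F y - F x) < (y - x) * (a x + a y).
Proof.
move=> xJ yJ xy.
pose g (t : R) : R := (t - x) * (a x + a t) - 2 * F t.
pose g' (t : R) : R := a x - a t + (t - x) * da t.
have g_deriv (t : R) : is_derive t 1 g (g' t).
  have at' := a_derive t; have Ft := F_anti t.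
  have -> : g = (id - cst x) * (cst (a x) + a) - (2 \*: F) by [].
  apply: is_derive_eq; rewrite /g' /GRing.scale /= !fctE /=; ring.
have [|c /[dup] /(itv_between xJ yJ) cJ] :=
  @MVT R g g' x y xy (fun t _ => g_deriv t).
  by apply: derivable_within_continuous => t _; apply: ex_derive.
rewrite in_itv /= => /andP[xc _]; rewrite /g subrr mul0r => gE.
have [d /[dup] /(itv_between xJ cJ) dJ] := flux_MVT xc.
rewrite in_itv /= => /andP[_ dc] acE.
have dadc := da_incr dJ cJ dc.
have : 0 < g' c * (y - x).
  apply: mulr_gt0; last by rewrite subr_gt0.
  have -> : g' c = (c - x) * (da c - da d).
    by rewrite /g' -[a x - a c]opprB acE; ring.
  by rewrite mulr_gt0 ?subr_gt0.
by rewrite -gE; lra.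
Qed.

(** This serves to exclude row relations that do not involve the third row. *)
Lemma flux_not_collinear (x y z : R) : x \in J -> y \in J -> z \in J ->
  x != y -> x != z -> y != z -> (a y - a x) * (z - y) <> (a z - a y) * (y - x).
Proof.
move=> xJ yJ zJ.
have [xy _|xy _|//] := ltgtP x y.
- have [xz _|xz _|//] := ltgtP x z.
  + have [yz _|yz _|//] := ltgtP y z.
    * by have := @flux_chord x y z xJ zJ; rewrite xy yz => /(_ isT); lra.
    * by have := @flux_chord x z y xJ yJ; rewrite xz yz => /(_ isT); lra.
  + by have := @flux_chord z x y zJ yJ; rewrite xz xy => /(_ isT); lra.
- have [xz _|xz _|//] := ltgtP x z.
  + by have := @flux_chord y x z yJ zJ; rewrite xz xy => /(_ isT); lra.
  + have [yz _|yz _|//] := ltgtP y z.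
    * by have := @flux_chord y z x yJ xJ; rewrite xz yz => /(_ isT); lra.
    * by have := @flux_chord z y x zJ xJ; rewrite xy yz => /(_ isT); lra.
Qed.

End ConvexFlux.

(** * Row relations on K_1 and exclusion of T_4 *)

Section RowRelation.
Context (R : realType) (a da F : R -> R) (J : interval R).
Hypothesis a_derive : forall x : R, is_derive x 1 a (da x).
Hypothesis F_anti : antiderivative F a.
Hypothesis a_incr : {in J &, {homo a : x y / x < y}}.
Hypothesis da_incr : {in J &, {homo da : x y / x < y}}.

(* The minor of the first two rows of P(u, v) - P(u', v'). *)
Let D (u u' v v' : R) := (u - u') ^+ 2 - (v - v') * (a v - a v').

(* With b = a + s, the two equations express that (u + t) b and
   (u + t)^2 / 2 + \int b are the same at both points; together they give
   (u' - u)^2 (b + b') = 2 (b' - b) \int_v^v' b, and strict convexity of b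
   compares the integral with the trapezoid rule. *)
Lemma quadratic_relation_sign (s t u u' v v' : R) :
  v \in J -> v' \in J -> v < v' ->
  (u + t) * (a v + s) = (u' + t) * (a v' + s) ->
  2^-1 * (u + t) ^+ 2 + (F v + s * v) = 2^-1 * (u' + t) ^+ 2 + (F v' + s * v') ->
  (a v + s + (a v' + s)) * D u' u v' v < 0.
Proof.
move=> vJ v'J vv' E1 E2.
have := flux_trapezoid a_derive F_anti da_incr vJ v'J vv'.
have av := a_incr vJ v'J vv'.
set b := a v in E1 av *; set b' := a v' in E1 av *.
move=> trap.
have E : (u' - u) ^+ 2 * (b + s + (b' + s)) =
         2 * (F v' + s * v' - (F v + s * v)) * (b' - b).
  have -> : F v' + s * v' - (F v + s * v) =
    2^-1 * (u + t) ^+ 2 - 2^-1 * (u' + t) ^+ 2 by lra.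
  have -> : (u' - u) ^+ 2 * (b + s + (b' + s)) = (u' - u) *
    (2 * ((u' + t) * (b' + s) - (u + t) * (b + s)) -
     (u' + u + 2 * t) * (b' - b)) by ring.
  by rewrite E1 subrr; field.
rewrite /D -/b -/b' mulrBr (mulrC _ ((u' - u) ^+ 2)) E.
have : 0 < (b' - b) * ((v' - v) * (b + b') - 2 * (F v' - F v)).
  by apply: mulr_gt0; lra.
nra.
Qed.

Lemma no_T4_on_convex_flux (T : 'I_4 -> 'M[R]_(3, 2)) (u v : 'I_4 -> R) :
  (forall i, v i \in J) -> (forall i, T i = Pmx a F (u i) (v i)) ->
  ~ TN_configuration T.
Proof.
move=> vJ TE TN.
have Tinj : injective T by case: TN.
pose E i j := D (u i) (u j) (v i) (v j).
have E01 i j : minor2 0 1 (T i - T j) = E i j.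
  by rewrite /minor2 !TE !mxE /= /E /D; ring.
(* Swapping the rows negates the minor, so [TN_minor2_sign] excludes either strict sign. *)
have E10 i j : minor2 1 0 (T i - T j) = - E i j.
  by rewrite /minor2 !TE !mxE /= /E /D; ring.
have E_le0 k : exists2 i, i != k & E i k <= 0.
  apply: contrapT => noi; apply: (@TN_minor2_sign _ _ _ _ 0 1 k TN) => i ik.
  by rewrite E01 ltNge; apply/negP => Eik; apply: noi; exists i.
have E_ge0 k : exists2 i, i != k & 0 <= E i k.
  apply: contrapT => noi; apply: (@TN_minor2_sign _ _ _ _ 1 0 k TN) => i ik.
  by rewrite E10 oppr_gt0 ltNge; apply/negP => Eik; apply: noi; exists i.
have uneq i j : i != j -> v i = v j -> u i != u j.
  move=> ij vij; apply: contra ij => /eqP uij.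
  by apply/eqP/Tinj; rewrite !TE uij vij.
have [l l0 lT] := TN_row_relation (isT : (4 <= 4)%N) TN.
(* In ['I_3], [1 + 1] is the index of the third row. *)
pose p := l 0 0; pose q := l 0 1; pose r := l 0 (1 + 1).
have lsum (w : 'cV[R]_3) :
    (l *m w) 0 0 = p * w 0 0 + q * w 1 0 + r * w (1 + 1) 0.
  rewrite mxE !big_ord_recl big_ord0 addr0 addrA.
  by congr (_ + _ + _ * _); [congr (_ * _)|..]; congr (_ _ _); apply: val_inj.
have col_rel j i k : p * T i 0 j + q * T i 1 j + r * T i (1 + 1) j =
                     p * T k 0 j + q * T k 1 j + r * T k (1 + 1) j.
  have /colP/(_ 0) : l *m col j (T i) = l *m col j (T k).
    by rewrite !colE !mulmxA (lT i k).
  by rewrite !lsum !mxE.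
have rel0 i k : p * u i + q * a (v i) + r * (u i * a (v i)) =
                p * u k + q * a (v k) + r * (u k * a (v k)).
  by have := col_rel 0 i k; rewrite !TE !mxE.
have rel1 i k :
    p * v i + q * u i + r * (2^-1 * u i ^+ 2 + F (v i)) =
    p * v k + q * u k + r * (2^-1 * u k ^+ 2 + F (v k)).
  by have := col_rel 1 i k; rewrite !TE !mxE.
(* If [r = 0], eliminating [u] makes [a (v i)] affine in [v i] with slope [(p / q) ^+ 2], on
   pairwise distinct [v i]. *)
have [r0|r0] := eqVneq r 0.
  have pq0 : p = 0 -> q = 0 -> False.
    move=> p0 q0; move/eqP: l0; apply; apply/rowP => k; rewrite mxE.
    case: k => [[|[|[|//]]] k3].
    - by rewrite -p0; congr (l _ _); apply: val_inj.
    - by rewrite -q0; congr (l _ _); apply: val_inj.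
    - by rewrite -r0; congr (l _ _); apply: val_inj.
  have {}rel0 i k : p * (u i - u k) + q * (a (v i) - a (v k)) = 0.
    by have := rel0 i k; rewrite r0; lra.
  have {}rel1 i k : p * (v i - v k) + q * (u i - u k) = 0.
    by have := rel1 i k; rewrite r0; lra.
  have vneq i j : i != j -> v i != v j.
    move=> ij; apply/eqP => vij; have := uneq _ _ ij vij.
    rewrite -subr_eq0 => uij.
    have := rel0 i j; have := rel1 i j; rewrite vij !subrr !mulr0 add0r addr0.
    move=> /eqP; rewrite mulf_eq0 (negPf uij) orbF => /eqP q0.
    by move=> /eqP; rewrite mulf_eq0 (negPf uij) orbF => /eqP /pq0.
  have q0 : q != 0.
    apply/eqP => q0; have := rel1 0 1; rewrite q0 mul0r addr0 => /eqP.
    rewrite mulf_eq0 subr_eq0 (negPf (vneq _ _ _)) // orbF => /eqP p0.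
    exact: pq0.
  have slope i j : q ^+ 2 * (a (v i) - a (v j)) = p ^+ 2 * (v i - v j).
    have -> : p ^+ 2 * (v i - v j) = p * (p * (v i - v j) + q * (u i - u j))
      - q * (p * (u i - u j) + q * (a (v i) - a (v j)))
      + q ^+ 2 * (a (v i) - a (v j)) by ring.
    by rewrite rel0 rel1; ring.
  apply: (flux_not_collinear a_derive da_incr (vJ 0) (vJ 1) (vJ (1 + 1)));
    rewrite ?vneq //.
  apply: (mulfI (expf_neq0 2 q0)); rewrite !mulrA !slope; ring.
(* Division by [r] turns [rel0] and [rel1] into the hypotheses of [quadratic_relation_sign], up to
   the constants [s * t] and [t ^+ 2 / 2]. *)
pose s := p / r; pose t := q / r.
have pE : p = r * s by rewrite /s mulrC divfK.
have qE : q = r * t by rewrite /t mulrC divfK.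
have sign i j : v i < v j -> (a (v i) + s + (a (v j) + s)) * E j i < 0.
  move=> vij; apply: (@quadratic_relation_sign s t) => //.
    apply: (mulfI r0); have := rel0 i j; rewrite pE qE => rel; lra.
  apply: (mulfI r0); have := rel1 i j; rewrite pE qE => rel; lra.
have EC i j : E i j = E j i by rewrite /E /D; ring.
have [x _ xmin] := arg_minP v (isT : xpredT (0 : 'I_4)).
have {}xmin i : v x <= v i := xmin i isT.
have [y _ ymax] := arg_maxP v (isT : xpredT (0 : 'I_4)).
have {}ymax i : v i <= v y := ymax i isT.
have a_le i j : v i <= v j -> a (v i) <= a (v j).
  by rewrite le_eqVlt => /predU1P[->//|/(a_incr (vJ i) (vJ j))/ltW].
have axy := a_le _ _ (xmin y).
(* If [v i = v x], then [E i x] is a positive square; otherwise [sign] makes the sum over [x] and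
   [i] positive, and [a (v i) <= a (v y)]. *)
have pos : 0 < a (v x) + s + (a (v y) + s).
  have [i ix Eix] := E_le0 x.
  have := xmin i; rewrite le_eqVlt => /predU1P[vxi|/sign].
    move: Eix; rewrite /E /D vxi subrr mul0r subr0 leNgt exprn_even_gt0 //=.
    by rewrite subr_eq0 (uneq _ _ ix (esym vxi)).
  have := a_le _ _ (ymax i); nra.
(* If [v i < v y], [sign] contradicts [pos]; if [v i = v y], [rel0] forces [a (v y) + s = 0],
   against [pos] by monotonicity of [a]. *)
have [i iy Eiy] := E_ge0 y.
have := ymax i; rewrite le_eqVlt => /predU1P[viy|/sign]; last first.
  rewrite EC; have := a_le _ _ (xmin i); nra.
have := uneq _ _ iy viy.
have : (u i - u y) * (a (v y) + s) = 0.
  apply: (mulfI r0); have := rel0 i y; rewrite pE qE viy => rel; lra.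
move=> /eqP; rewrite mulf_eq0 subr_eq0 => /orP[->//|/eqP ay0 _].
by move: pos axy; lra.
Qed.

End RowRelation.

(** * Localization near v0 *)

Lemma derive1_gt0_incr (R : realType) (f : R -> R) (c d : R) :
  (forall x : R, derivable f x 1) ->
  {in `]c, d[%R, forall x, 0 < derive1 f x} ->
  {in `]c, d[%R &, {homo f : x y / x < y}}.
Proof.
move=> df f'_gt0; apply: gtr0_derive1_lt_oo.
- by move=> x _; exact: df.
- exact: f'_gt0.
- by move=> x _; apply/differentiable_continuous/derivable1_diffP; exact: df.
Qed.

Theorem corollary3 (R : realType) (a F : R -> R) (v0 : R)
    (a_C2 : class_C 2 a)
    (a'_gt0 : 0 < a^`() v0)
    (a''_gt0 : 0 < a^`(2) v0)
    (F_anti : antiderivative F a) :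
  forall u0 : R, exists U : set 'M[R]_(3, 2),
    nbhs (Pmx a F u0 v0) U /\
    ~ exists T : 'I_4 -> 'M[R]_(3, 2),
        (forall i, (K1 a F `&` U) (T i)) /\ TN_configuration T.
Proof.
move=> u0; have [a_derivable a2_cont] := a_C2.
have a0 x : derivable a x 1 := a_derivable 0%N isT x.
have a1 x : derivable (derive1 a) x 1 := a_derivable 1%N isT x.
have a1_cont : {for v0, continuous (derive1 a)}.
  exact/differentiable_continuous/derivable1_diffP.
have [e /= e0 He] :
    \forall x \near v0, 0 < derive1 a x /\ 0 < derive1 (derive1 a) x.
  near=> x; split; near: x; [exact: cvgr_gt a1_cont _ _|].
  exact: cvgr_gt (a2_cont v0) _ a''_gt0.
pose J := `]v0 - e, v0 + e[%R.
have JE x : x \in J -> 0 < derive1 a x /\ 0 < derive1 (derive1 a) x.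
  rewrite /J in_itv /= => xJ; apply: He => /=; rewrite distrC ltr_distl //.
(* The neighborhood constrains only the entry [v]; [u] stays arbitrary. *)
exists [set M | M 0 1 \in J]; split.
  apply: (@coord_continuous R 3 2 0 1 (Pmx a F u0 v0) [set` J]).
  apply: near_in_itvoo; rewrite mxE /= in_itv /=; lra.
move=> [T [TK]]; have /choice[uv uvE] i : exists w : R * R,
    w.2 \in J /\ T i = Pmx a F w.1 w.2.
  have [[u [v TE]] TJ] := TK i; exists (u, v); split => //.
  by move: TJ; rewrite /= TE mxE.
apply: (@no_T4_on_convex_flux R a (derive1 a) F J _ F_anti _ _ T
  (fst \o uv) (snd \o uv)).
- move=> x; rewrite derive1E; exact: (derivableP (a0 x)).
- exact: (derive1_gt0_incr a0 (fun x xJ => (JE x xJ).1)).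
- exact: (derive1_gt0_incr a1 (fun x xJ => (JE x xJ).2)).
- by move=> i; case: (uvE i).
- by move=> i; case: (uvE i).
Unshelve. all: by end_near. Qed.
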